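(* A topological space $X$ is weakly $\alpha$-favorable (i.e. player $\alpha$ has a winning strategy in the Banach--Mazur game $BM(X)$) if and only if $X$ is F-Y countably $\pi$-domain representable.
   Context: No separation axioms are assumed. For a topological space $X$, $\tau(X)$ denotes its topology and $\tau^*(X)$ the family of nonempty open sets. A family $\mathcal P$ of nonempty open sets is a $\pi$-base if for every nonempty open $U$ there is $P\in\mathcal P$ with $P\subseteq U$. Banach--Mazur game $BM(X)$: players $\beta$ and $\alpha$ alternately choose nonempty open sets, $\beta$ starting, with $U_0\supseteq V_0\supseteq U_1\supseteq V_1\supseteq\cdots$, where the $U_n$ are chosen by $\beta$ and the $V_n$ by $\alpha$. Player $\alpha$ wins the play if $\bigcap_{n\in\omega}V_n\neq\emptyset$; otherwise $\beta$ wins. A strategy for $\alpha$ is a map $s$ assigning to each finite legal sequence $(U_0,\ldots,U_n)$ of moves of $\beta$ (a partial play, in which $\alpha$'s responses are $V_k=s(U_0,\ldots,U_k)$ and $U_{k+1}\subseteq V_k$) a nonempty open set $V_n=s(U_0,\ldots,U_n)\subseteq U_n$. The strategy $s$ is winning if $\bigcap_{n}V_n\ne\emptyset$ for every infinite play in which $V_n=s(U_0,\ldots,U_n)$ for all $n$. The space $X$ is weakly $\alpha$-favorable if $\alpha$ has a winning strategy in $BM(X)$. A set $D$ with a relation $\ll$ is upward directed if it is nonempty and for all $p,q\in D$ (not necessarily distinct) there is $r\in D$ with $p\ll r$ and $q\ll r$. $X$ is F-Y (Fleissner--Yengulalp) countably $\pi$-domain representable if there is a triple $(Q,\ll,B)$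 such that: ($\pi$D1) $B:Q\to\tau^*(X)$ and $\{B(q):q\in Q\}$ is a $\pi$-base for $\tau(X)$; ($\pi$D2) $\ll$ is a transitive relation on $Q$ (antisymmetry is not assumed); ($\pi$D3) for all $p,q\in Q$, $p\ll q$ implies $B(p)\supseteq B(q)$; ($\pi$D4) if $p,q\in Q$ satisfy $B(q)\cap B(p)\neq\emptyset$, there exists $r\in Q$ with $p\ll r$ and $q\ll r$; ($\pi$D5$_{\omega_1}$) if $D\subseteq Q$ and $(D,\ll)$ is countable and upward directed, then $\bigcap\{B(q):q\in D\}\neq\emptyset$. *)

(* Defs.v *)
From mathcomp Require Import all_boot all_order all_algebra.
From mathcomp Require Import all_classical topology.

Set Implicit Arguments.
Unset Strict Implicit.
Unset Printing Implicit Defensive.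

Local Open Scope classical_set_scope.

Section BanachMazur.
Context {X : topologicalType}.

Definition nonempty_open : set (set X) := [set U | open U /\ U !=set0].

Definition pi_base (P : set (set X)) : Prop :=
  P `<=` nonempty_open /\
  forall U, nonempty_open U -> exists2 W, P W & W `<=` U.

(* [U n] are the moves of beta, who starts, and [V n] those of alpha. *)
Definition BM_play (U V : nat -> set X) : Prop :=
  forall n, [/\ nonempty_open (U n), nonempty_open (V n),
                V n `<=` U n & U n.+1 `<=` V n].

Definition alpha_wins (V : nat -> set X) : Prop := \bigcap_n V n !=set0.

(* [us = [:: U_0; ...; U_n]] lists moves of beta in a partial play where alpha
   answers [U_0, ..., U_k] by [s [:: U_0; ...; U_k]]. *)
Definition legal (s : seq (set X) -> set X) (us : seq (set X)) : Prop :=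
  [/\ (0 < size us)%N,
      forall k, (k < size us)%N -> nonempty_open (nth set0 us k) &
      forall k, (k.+1 < size us)%N ->
        nth set0 us k.+1 `<=` s (take k.+1 us)].

(* Strategies are total functions whose values on sequences that are not legal
   are irrelevant: neither this condition nor [winning] depends on them. *)
Definition alpha_strategy (s : seq (set X) -> set X) : Prop :=
  forall us, legal s us ->
    nonempty_open (s us) /\ s us `<=` last set0 us.

Definition winning (s : seq (set X) -> set X) : Prop :=
  forall U V : nat -> set X, BM_play U V ->
    (forall n, V n = s (mkseq U n.+1)) -> alpha_wins V.

End BanachMazur.

Definition weakly_alpha_favorable (X : topologicalType) : Prop :=
  exists s : seq (set X) -> set X, alpha_strategy s /\ winning s.

Definition upward_directed (Q : Type) (ll : Q -> Q -> Prop) (D : set Q) : Prop :=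
  D !=set0 /\
  forall p q, D p -> D q -> exists r, [/\ D r, ll p r & ll q r].

Record FY_countable_pi_domain (X : topologicalType) (Q : Type)
    (ll : Q -> Q -> Prop) (B : Q -> set X) : Prop := {
  piD1_open : forall q, nonempty_open (B q);
  piD1 : pi_base (range B);
  piD2 : forall p q r, ll p q -> ll q r -> ll p r;
  piD3 : forall p q, ll p q -> B q `<=` B p;
  piD4 : forall p q, B q `&` B p !=set0 -> exists r, ll p r /\ ll q r;
  piD5 : forall D : set Q, countable D -> upward_directed ll D ->
    \bigcap_(q in D) B q !=set0
}.

Definition FY_countably_pi_domain_representable (X : topologicalType) : Prop :=
  exists (Q : Type) (ll : Q -> Q -> Prop) (B : Q -> set X),
    FY_countable_pi_domain ll B.

(* Main.v *)
Require Import Defs.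
From mathcomp Require Import all_boot all_order all_algebra.
From mathcomp Require Import all_classical topology.

(** If [B] is a countable pi-domain, alpha answers each move [U] of beta by a
    [B q] inside [U] with [q] above the index of the previous answer; the
    indices form a countable directed set.

    Conversely, let [s] be a winning strategy. The domain consists of finite
    nonempty families of partial plays together with an open set contained in
    all the answers of [s]; a family lies below another one if each of its plays
    is continued in the latter by a move inside its open set. Finiteness makes
    the relation directed on families with intersecting open sets: their plays
    are extended one after the other, with shrinking moves. Along a chain cofinal
    in a countable directed set, the continuations join up to an infinite play,
    and a point given by the victory of alpha lies in every open set of the chain. *)

Set Implicit Arguments.
Unset Strict Implicit.
Unset Printing Implicit Defensive.

Local Open Scope classical_set_scope.

(** Enumerate [D] by [f] and let each term of the chain be a bound in [D] of the previous term and
    of the next value of [f]. *)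
Lemma upward_directed_cofinal_chain (Q : Type) (ll : Q -> Q -> Prop)
    (D : set Q) :
  countable D -> upward_directed ll D ->
  exists c : nat -> Q, [/\ forall n, D (c n), forall n, ll (c n) (c n.+1) &
    forall q, D q -> exists n, ll q (c n)].
Proof.
move=> /pfcard_geP[D0 [/set0P/eqP//]|[f] [_ dirD]].
have fD n : D (f n) by apply: funS.
have /choice[j jP] (pq : Q * Q) : exists r, D pq.1 -> D pq.2 ->
    [/\ D r, ll pq.1 r & ll pq.2 r].
  have [[Dp Dq]|nD] := pselect (D pq.1 /\ D pq.2); last first.
    by exists pq.1 => Dp Dq; case: nD.
  by have [r rP] := dirD _ _ Dp Dq; exists r.
pose c := nat_rect (fun=> Q) (f 0%N) (fun n q => j (q, f n)).
have cD n : D (c n) by elim: n => [|n IH] //=; have [] := jP (c n, f n) IH (fD n).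
exists c; split=> // [n|q Dq].
  by have [] := jP (c n, f n) (cD n) (fD n).
have [n _ <-] := @surj _ _ _ _ f q Dq.
by exists n.+1; have [] := jP (c n, f n) (cD n) (fD n).
Qed.

Section Chains.
Context (T : Type) (r : T -> T -> Prop) (c : nat -> T).
Hypothesis r_trans : forall x y z, r x y -> r y z -> r x z.
Hypothesis c_chain : forall n, r (c n) (c n.+1).

Lemma chain_lt m n : (m < n)%N -> r (c m) (c n).
Proof.
elim: n => // n IH; rewrite ltnS leq_eqVlt => /predU1P[->//|/IH mn].
exact: r_trans mn (c_chain n).
Qed.

Lemma chain_upward_directed : upward_directed r (range c).
Proof.
split; first by exists (c 0), 0.
move=> _ _ [m _ <-] [n _ <-]; exists (c (maxn m n).+1).
by split; [exists (maxn m n).+1| |]; rewrite //; apply: chain_lt;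
  rewrite ltnS ?leq_maxl ?leq_maxr.
Qed.

End Chains.

Section Legal.
Context {X : topologicalType} (s : seq (set X) -> set X).

Lemma legal1 U : nonempty_open U -> legal s [:: U].
Proof. by move=> oU; split=> // -[]. Qed.

Lemma legal_rcons us U : legal s us -> nonempty_open U -> U `<=` s us ->
  legal s (rcons us U).
Proof.
move=> [us0 us_open us_sub] oU Us; split; rewrite size_rcons // => k.
  by rewrite ltnS nth_rcons; case: ltngtP => // /us_open.
rewrite !ltnS leq_eqVlt => /predU1P[kE|kus].
  by rewrite nth_rcons kE ltnn eqxx -cats1 take_size_cat.
by rewrite nth_rcons kus -cats1 takel_cat ?(ltnW kus) //; apply: us_sub.
Qed.

Lemma legal_take us n : legal s us -> (0 < n)%N -> legal s (take n us).
Proof.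
move=> [us0 us_open us_sub] n0; split=> [|k|k]; rewrite size_take_min leq_min.
- by rewrite n0.
- by move=> /andP[kn kus]; rewrite nth_take //; apply: us_open.
- move=> /andP[kn kus]; rewrite nth_take // take_takel; last exact: ltnW.
  exact: us_sub.
Qed.

Lemma legal_last us U : legal s (rcons us U) -> nonempty_open U.
Proof.
move=> [_ /(_ (size us))]; rewrite size_rcons nth_rcons ltnn eqxx => + _.
exact.
Qed.

Lemma legal_last_sub us U : legal s (rcons us U) -> us = [::] \/ U `<=` s us.
Proof.
case/lastP: us => [|us U']; first by left.
move=> [_ _ /(_ (size us))]; rewrite !size_rcons => /(_ (ltnSn _)).
rewrite nth_rcons size_rcons ltnn eqxx -(size_rcons us U') -(cats1 _ U).
by rewrite take_size_cat //; right.
Qed.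

(** Beta plays the current open set in the first play, and the answer of [s] becomes the current set
    for the remaining plays. Sets only shrink, so the final one lies in every answer. *)
Lemma extend_plays (F : seq (seq (set X))) W : alpha_strategy s ->
  nonempty_open W ->
  (forall us, us \in F -> legal s us /\ W `<=` s us) ->
  exists (G : seq (seq (set X))) W', [/\ nonempty_open W', W' `<=` W,
    forall us, us \in G -> legal s us /\ W' `<=` s us &
    forall us, us \in F -> exists2 U, U `<=` W & rcons us U \in G].
Proof.
move=> strat; elim: F W => [|us F IH] W oW FW.
  by exists [::], W; split.
have [lus Wus] := FW us (mem_head _ _).
have lusW := legal_rcons lus oW Wus.
have [oW1] := strat _ lusW; rewrite last_rcons => W1W.
have [vs vsF|G [W' [oW' W'W1 GP FG]]] := IH _ oW1.
  have [lvs Wvs] : legal s vs /\ W `<=` s vs by apply: FW; rewrite inE vsF orbT.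
  by split=> //; apply: subset_trans Wvs.
exists (rcons us W :: G), W'; split=> // [|vs|vs].
- exact: subset_trans W1W.
- by rewrite inE => /predU1P[->//|/GP].
- rewrite inE => /predU1P[->|/FG[U UW1 UG]].
    by exists W => //; rewrite mem_head.
  by exists U; [exact: subset_trans W1W|rewrite inE UG orbT].
Qed.

(** The [us n] are initial segments of one infinite play in which alpha follows [s]. A point common
    to the answers of alpha lies in all moves of beta. *)
Lemma legal_limit (us : nat -> seq (set X)) : alpha_strategy s -> winning s ->
  (forall n, legal s (us n)) ->
  (forall n, exists U vs, us n.+1 = us n ++ U :: vs) ->
  exists x, forall n i, (i < size (us n))%N -> nth set0 (us n) i x.
Proof.
move=> strat win lus ext.
have us_size n : (n < size (us n))%N.
  elim: n => [|n IH]; first by have [] := lus 0%N.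
  by have [U [vs ->]] := ext n; rewrite size_cat /= addnS ltnS (leq_trans IH) ?leq_addr.
have nth_us m n i : (m <= n)%N -> (i < size (us m))%N ->
    (i < size (us n))%N /\ nth set0 (us n) i = nth set0 (us m) i.
  move=> + im; elim: n => [|n IH]; first by rewrite leqn0 => /eqP <-.
  rewrite leq_eqVlt => /predU1P[<-//|/IH[iN <-]].
  have [U [vs ->]] := ext n; rewrite nth_cat iN size_cat; split=> //.
  by rewrite (leq_trans iN) ?leq_addr.
(* By [us_size], the default value [set0] is never reached. *)
pose U n := nth set0 (us n) n.
have UE n i : (i < size (us n))%N -> U i = nth set0 (us n) i.
  move=> iN; rewrite /U; case: (leqP i n) => [/nth_us/(_ (us_size i))[]//|/ltnW ni].
  by have [] := nth_us _ _ _ ni iN.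
have mkU m n : (n <= size (us m))%N -> mkseq U n = take n (us m).
  move=> nm; apply: (@eq_from_nth _ set0); rewrite size_mkseq ?size_takel//.
  by move=> i iN; rewrite nth_mkseq // nth_take // (UE m) // (leq_trans iN).
have lU n : legal s (mkseq U n.+1).
  by rewrite (mkU n) //; apply: legal_take.
pose V n := s (mkseq U n.+1).
have [n|x Vx] := win U V _ (fun=> erefl).
  have := lU n; have := lU n.+1; rewrite /V; have [] := strat _ (lU n).
  rewrite !(mkseqS U) last_rcons => oV VU /legal_last_sub[nil|UV] /legal_last oU.
    by case: (mkseq U n) nil.
  by split=> //; rewrite mkseqS.
exists x => n i iN; rewrite -(UE n i iN).
have [_] := strat _ (lU i); rewrite {2}mkseqS last_rcons; apply; exact: Vx.
Qed.

End Legal.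

Section FavorableOfDomain.
Context {X : topologicalType} {Q : Type} {ll : Q -> Q -> Prop} {B : Q -> set X}.
Hypothesis dom : FY_countable_pi_domain ll B.

(** [None] is the state before the first move, when beta is unrestricted. *)
Let answer (o : option Q) : set X := if o is Some q then B q else setT.

Let next (o : option Q) (U : set X) (q : Q) :=
  B q `<=` U /\ forall p, o = Some p -> ll p q.

(** Some [B p] fits inside the move. If the move lies in [B q], then [B p] meets [B q], and [piD4]
    gives an index above both. The conditions on the move stand under the existential so that choice
    yields a total function. *)
Lemma domain_next (oU : option Q * set X) : exists o',
  nonempty_open oU.2 -> oU.2 `<=` answer oU.1 ->
  exists2 q, o' = Some q & next oU.1 oU.2 q.
Proof.
case: oU => o U /=; have [oU|noU] := pselect (nonempty_open U); last first.
  by exists None => /noU.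
have [_ /(_ _ oU)[_ [p _ <-] pU]] := piD1 dom.
case: o => [q|]; last by exists (Some p) => _ _; exists p.
have [Uq|nUq] := pselect (U `<=` B q); last by exists None => _ /nUq.
have [|r [pr qr]] := @piD4 _ _ _ _ dom p q.
  have [_ [x px]] := piD1_open dom p; exists x; split=> //; exact/Uq/pU.
exists (Some r) => _ _; exists r => //; split=> [|_ [<-]//].
exact: subset_trans (piD3 dom pr) pU.
Qed.

Lemma favorable_of_domain : weakly_alpha_favorable X.
Proof.
have [step stepP] := choice domain_next.
(* The index of the last answer is recomputed from the moves of beta. *)
pose st := foldl (fun o U => step (o, U)) None.
have stP us U : nonempty_open U -> U `<=` answer (st us) ->
    exists2 q, st (rcons us U) = Some q & next (st us) U q.
  by move=> oU Ust; rewrite /st foldl_rcons; apply: (stepP (_, _)).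
exists (answer \o st); split=> [us|U V UV VE].
  case/lastP: us => [[]//|us U] lus; rewrite last_rcons.
  have Ust : U `<=` answer (st us) by have [->|] := legal_last_sub lus.
  have [q /= -> [qU _]] := stP _ _ (legal_last lus) Ust.
  by split=> //; apply: piD1_open dom q.
have stU n : exists q, st (mkseq U n.+1) = Some q /\ next (st (mkseq U n)) (U n) q.
  rewrite mkseqS; have [oU _ _ _] := UV n; have [|q qE qP] := stP (mkseq U n) _ oU.
    by case: n {oU} => // n; have [_ _ _] := UV n; rewrite VE.
  by exists q.
have [q qP] := choice stU.
have VB n : V n = B (q n) by rewrite VE /=; have [->] := qP n.
have q_chain n : ll (q n) (q n.+1).
  by have [_ [_]] := qP n.+1; apply; have [] := qP n.
have [x xP] : \bigcap_(p in range q) B p !=set0.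
  apply: (piD5 dom); first exact: card_image_le.
  exact: chain_upward_directed (@piD2 _ _ _ _ dom) q_chain.
by exists x => n _; rewrite VB; apply: xP; exists n.
Qed.

End FavorableOfDomain.

Section DomainOfFavorable.
Context {X : topologicalType} {s : seq (set X) -> set X}.
Hypotheses (strat : alpha_strategy s) (win : winning s).

(** Having at least one play in each family provides a play to follow along a chain. *)
Record play_family := PlayFamily {
  plays : seq (seq (set X));
  common : set X;
  plays_neq0 : exists us, us \in plays;
  common_open : nonempty_open common;
  plays_legal : forall us, us \in plays -> legal s us /\ common `<=` s us
}.

(** At least one move is added, so plays grow without bound along a chain; the first new move ties
    the limit play to [common p]. *)
Definition refines (p q : play_family) : Prop :=
  common q `<=` common p /\
  forall us, us \in plays p -> exists U vs,
    U `<=` common p /\ us ++ U :: vs \in plays q.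

Lemma refines_trans p q r : refines p q -> refines q r -> refines p r.
Proof.
move=> [qp pq] [rq qr]; split=> [|us /pq[U [vs [Up /qr[U' [vs' [_ usr]]]]]]].
  exact: subset_trans qp.
by exists U, (vs ++ U' :: vs'); split=> //; rewrite -cat_cons catA.
Qed.

Lemma refines_directed p q : common q `&` common p !=set0 ->
  exists r, refines p r /\ refines q r.
Proof.
move=> qp0.
have oW : nonempty_open (common q `&` common p).
  by split=> //; apply: openI; [case: (common_open q)|case: (common_open p)].
(* The intersection lies in every answer of both families, so all their plays can be extended
   together. *)
have [us|G [W [oG GW GP FG]]] := @extend_plays X s (plays p ++ plays q) _ strat oW.
  by rewrite mem_cat => /orP[] /plays_legal[lus sub]; split=> // x [? ?]; apply: sub.
have G0 : exists us, us \in G.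
  have [us usp] := plays_neq0 p.
  have [|U _ UG] := FG us; first by rewrite mem_cat usp.
  by exists (rcons us U).
exists (PlayFamily G0 oG GP); split; split=> /= [|us usF].
1,3: by move=> x /GW[].
all: have [|U UW UG] := FG us; first by rewrite mem_cat usF ?orbT.
all: by exists U, [::]; rewrite cats1; split=> // x /UW[].
Qed.

Lemma refines_chain (p : nat -> play_family) :
  (forall n, refines (p n) (p n.+1)) -> \bigcap_n common (p n) !=set0.
Proof.
move=> chain.
have /choice[e eP] (nus : nat * seq (set X)) : exists vs,
    nus.2 \in plays (p nus.1) -> vs \in plays (p nus.1.+1) /\
    exists U ws, U `<=` common (p nus.1) /\ vs = nus.2 ++ U :: ws.
  case: nus => n us /=; have [usp|] := boolP (us \in plays (p n)); last by exists us.
  have [_ /(_ us usp)[U [ws [Up usU]]]] := chain n.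
  by exists (us ++ U :: ws); split=> //; exists U, ws.
have [us0 us0p] := plays_neq0 (p 0%N).
pose us := nat_rect (fun=> seq (set X)) us0 (fun n v => e (n, v)).
have usp n : us n \in plays (p n).
  by elim: n => //= n IH; have [] := eP (n, us n) IH.
have us_ext n : exists U ws, U `<=` common (p n) /\ us n.+1 = us n ++ U :: ws.
  by have [] := eP (n, us n) (usp n).
have [n|n|x xP] := legal_limit (us := us) strat win.
- by have [] := plays_legal (usp n).
- by have [U [ws [_ ->]]] := us_ext n; exists U, ws.
exists x => n _; have [U [ws [Up usE]]] := us_ext n; apply: Up.
(* The move of [us n.+1] at position [size (us n)] is [U], the first one added to [us n]. *)
have := xP n.+1 (size (us n)); rewrite usE size_cat nth_cat ltnn subnn /=; apply.
by rewrite addnS ltnS leq_addr.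
Qed.

(** Take the single play [[:: U]] with its answer as common set. *)
Lemma play_family_sub U : nonempty_open U -> exists p, common p `<=` U.
Proof.
move=> oU; have lU := legal1 s oU; have [osU sUU] := strat lU.
have F0 : exists us, us \in [:: [:: U]] by exists [:: U]; rewrite mem_head.
have FP us : us \in [:: [:: U]] -> legal s us /\ s [:: U] `<=` s us.
  by rewrite inE => /eqP ->; split.
by exists (PlayFamily F0 osU FP).
Qed.

Lemma domain_of_favorable : FY_countable_pi_domain refines common.
Proof.
split.
- exact: common_open.
- split=> [_ [p _ <-]|U /play_family_sub[p pU]]; first exact: common_open.
  by exists (common p) => //; exists p.
- exact: refines_trans.
- by move=> p q [].
- exact: refines_directed.
- move=> D cD /(upward_directed_cofinal_chain cD)[c [_ chain cof]].
  have [x xP] := refines_chain chain.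
  by exists x => q /cof[n [sub _]]; apply: sub; apply: xP.
Qed.

End DomainOfFavorable.

Theorem theorem1 (X : topologicalType) :
  weakly_alpha_favorable X <-> FY_countably_pi_domain_representable X.
Proof.
split=> [[s [strat win]]|[Q [ll [B dom]]]]; last exact: favorable_of_domain dom.
exists (play_family (s := s)), (@refines X s), (@common X s).
exact: domain_of_favorable.
Qed.
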